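(* Let $G=(V,E)$ be a connected unweighted graph on $n$ vertices with shortest-path metric $\delta$, accessed through a distance oracle, and let $f$ be a sublinear function of $n$. The randomized algorithm $\textsc{Approx-Reconstruction}(V)$ described in the context computes an $f$-approximation $\widehat{\delta}$ of $\delta$, using an expected number of $O(n^2(\log n)/f)$ queries.
   Context: Query model: $V$ is given and $\delta$ is accessible only via an oracle returning $\delta(u,v)$ for a queried pair; cost is the number of queries. A function $\widehat{\delta}$ on pairs is an $f$-approximation of $\delta$ if $\widehat{\delta}(u,v)\leq\delta(u,v)\leq f\cdot\widehat{\delta}(u,v)$ for every pair $(u,v)$ of distinct vertices. Algorithm $\textsc{Approx-Reconstruction}(V)$: while $\widehat{\delta}$ is not defined on every pair of nodes: choose $u\in V$ uniformly at random; query $(u,v)$ for every $v\in V$ and set $\widehat{\delta}(u,v)=\delta(u,v)$; let $S_u=\{v:\delta(u,v)<f/2\}$; for every $v\in S_u\setminus\{u\}$, set $\widehat{\delta}(v,w)=1$ for every $w\in S_u\setminus\{v\}$ and $\widehat{\delta}(v,w)=\delta(u,w)-\delta(u,v)$ for every $w\notin S_u$. Return $\widehat{\delta}$.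
   Formalization: The sublinear function f is taken to have positive integer values; for non-integer f the claim fails, e.g. f = 5/2 on the path v-u-x-w with u picked first gives estimate 1 for the pair (v,w) at distance 3. *)

(* Defs.v *)
From HB Require Import structures.
From mathcomp Require Import all_boot all_order all_algebra.
From mathcomp Require Import all_classical all_reals all_analysis.

Set Implicit Arguments.
Unset Strict Implicit.
Unset Printing Implicit Defensive.

Import Order.TTheory GRing.Theory Num.Theory.
Import numFieldNormedType.Exports.

Local Open Scope classical_set_scope.
Local Open Scope ring_scope.

Definition walk (V : finType) (e : rel V) (u v : V) (k : nat) : bool :=
  [exists p : k.-tuple V, path e u p && (last u p == v)].

(* [find] on [iota 0 _] returns the least length of a walk. Lengths below #|V|
   suffice (dist_walk, dist_min); for v unreachable from u the value is the
   junk value #|V|. *)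
Definition dist (V : finType) (e : rel V) (u v : V) : nat :=
  find (walk e u v) (iota 0 #|V|).

Lemma walkP (V : finType) (e : rel V) (u v : V) (k : nat) :
  reflect (exists p, [/\ path e u p, last u p = v & size p = k])
          (walk e u v k).
Proof.
apply: (iffP existsP) => [[p /andP[ep /eqP lp]]|[p [ep lp sp]]].
  by exists p; rewrite size_tuple.
by move/eqP: sp => sp; exists (Tuple sp); rewrite /= ep lp eqxx.
Qed.

Lemma walk_lt_card (V : finType) (e : rel V) (u v : V) (k : nat) :
  walk e u v k -> exists2 j, (j <= k)%N & (j < #|V|)%N && walk e u v j.
Proof.
case/walkP=> p [ep lp <-]; move: lp; case/shortenP: ep => q eq uq sq lq.
exists (size q); first by apply: uniq_leq_size => //; case/andP: uq.
apply/andP; split; first by have := max_card [in u :: q]; rewrite (card_uniqP uq).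
by apply/walkP; exists q.
Qed.

Lemma dist_walk (V : finType) (e : rel V) (u v : V) :
  connect e u v -> walk e u v (dist e u v).
Proof.
case/connectP=> p ep lp.
have /walk_lt_card[j _ /andP[jV wj]] : walk e u v (size p).
  by apply/walkP; exists p.
have hs : has (walk e u v) (iota 0 #|V|).
  by apply/hasP; exists j => //; rewrite mem_iota.
have := nth_find 0%N hs; rewrite nth_iota ?add0n //.
by move: hs; rewrite has_find size_iota.
Qed.

Lemma dist_min (V : finType) (e : rel V) (u v : V) (k : nat) :
  walk e u v k -> (dist e u v <= k)%N.
Proof.
case/walk_lt_card=> j jk /andP[jV wj]; apply: leq_trans jk.
rewrite leqNgt; apply/negP => /(before_find 0%N).
by rewrite nth_iota // add0n wj.
Qed.

Inductive oracle_prog (V A : Type) : Type :=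
| Return of A
| Query of V & V & (nat -> oracle_prog V A).
Arguments Return {V A}.

Fixpoint eval (V A : Type) (delta : V -> V -> nat) (p : oracle_prog V A) : A :=
  match p with
  | Return a => a
  | Query u v k => eval delta (k (delta u v))
  end.

Fixpoint queries (V A : Type) (delta : V -> V -> nat) (p : oracle_prog V A)
    : nat :=
  match p with
  | Return _ => 0
  | Query u v k => (queries delta (k (delta u v))).+1
  end.

Fixpoint query_all (V : eqType) (A : Type) (u : V) (vs : seq V) (r : V -> nat)
    (k : (V -> nat) -> oracle_prog V A) : oracle_prog V A :=
  if vs is v :: vs' then
    Query u v (fun d =>
      query_all u vs' (fun w => if w == v then d else r w) k)
  else k r.

Definition estimate (V : Type) := V -> V -> option nat.

(* Pairs of vertices are unordered: assigning (x, y) also assigns (y, x). *)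
Definition assign (V : eqType) (h : estimate V) (x y : V) (d : nat)
    : estimate V :=
  fun a b => if ((a == x) && (b == y)) || ((a == y) && (b == x))
             then Some d else h a b.

Definition fully_defined (V : finType) (h : estimate V) : bool :=
  [forall u, forall v, (u != v) ==> isSome (h u v)].

(* r is the table of oracle answers delta(u, .). The condition 2 r(v) < f is
   delta(u, v) < f/2; the natural subtraction below never truncates, since
   r v < r w when v \in S and w \notin S. *)
Definition update (V : finType) (f : nat) (u : V) (r : V -> nat)
    (h : estimate V) : estimate V :=
  let S := [set v | (2 * r v < f)%N]%SET in
  let h1 := foldl (fun h v => assign h u v (r v)) h (enum V) in
  foldl (fun h v =>
      foldl (fun h w =>
          assign h v w (if w \in S then 1%N else (r w - r v)%N))
        h (enum (predC1 v)))
    h1 (enum (S :\ u)%SET).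

(* The algorithm fed with finitely many of its random choices of u; it is cut
   off, possibly with an incomplete estimate, when these are exhausted. *)
Fixpoint approx_reconstruction_from (V : finType) (f : nat) (h : estimate V)
    (us : seq V) : oracle_prog V (estimate V) :=
  if fully_defined h then Return h else
  if us is u :: us' then
    query_all u (enum V) (fun _ => 0%N)
      (fun r => approx_reconstruction_from f (update f u r h) us')
  else Return h.

Definition approx_reconstruction (V : finType) (f : nat) (us : seq V)
    : oracle_prog V (estimate V) :=
  approx_reconstruction_from f (fun _ _ => None) us.

Definition returns (V : finType) (delta : V -> V -> nat) (f : nat)
    (us : nat -> V) (h : estimate V) : Prop :=
  exists t, h = eval delta (approx_reconstruction f (mkseq us t))
    /\ fully_defined h.

(* The counts are nondecreasing in t and constant once the loop has ended, so
   the supremum is the number of queries of the whole execution; it is +oo for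
   an execution that does not terminate. *)
Definition total_queries (R : realType) (V : finType) (delta : V -> V -> nat)
    (f : nat) (us : nat -> V) : \bar R :=
  ereal_sup (range (fun t : nat =>
    ((queries delta (approx_reconstruction f (mkseq us t)))%:R : R)%:E)).

(* The ratio f must be an integer: for f = 5/2, on a path v - u - x - w, the
   round that picks u sets the estimate of (v, w) to 1 while
   delta(v, w) = 3 > f. *)
Definition approximates (V : finType) (f : nat) (delta : V -> V -> nat)
    (h : estimate V) : Prop :=
  forall u v, u != v ->
    exists2 d, h u v = Some d & (d <= delta u v <= f * d)%N.

Definition iid_uniform (R : realType) (d : measure_display)
    (Omega : measurableType d) (P : probability Omega R) (V : finType)
    (U : nat -> Omega -> V) : Prop :=
  [/\ forall k (A : {set V}), measurable [set w | U k w \in A],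
      forall k v, P [set w | U k w = v] = ((#|V|%:R : R)^-1)%:E
    & forall (I : seq nat) (A : nat -> {set V}), uniq I ->
        P [set w | forall i, i \in I -> U i w \in A i] =
        (\prod_(i <- I) P [set w | U i w \in A i])%E ].

Definition sublinear (R : realType) (f : nat -> nat) : Prop :=
  (fun n => (f n)%:R / n%:R : R) @ \oo --> (0 : R).

(* Main.v *)
(* Every assignment made in a round is an f-approximation by the triangle
   inequality, and the round that picks u completes the rows of all v in the
   ball S_u; hence the loop ends once the picked vertices meet the ball of
   radius f/2 around every vertex. A shortest path leaving such a ball shows
   that it has at least f/2 elements (if f <= n), so by the union bound the loop
   is still running after t rounds with probability at most n (1 - p)^t, where
   p = f/2n. Summing over t, with the bound 1 for the first (ln n)/p rounds, gives
   O((ln n)/p) expected rounds of n queries each. *)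

Require Import Defs.
From HB Require Import structures.
From mathcomp Require Import all_boot all_order all_algebra.
From mathcomp Require Import all_classical all_reals all_analysis.
From mathcomp Require Import measurable_realfun.
From mathcomp Require Import zify ring lra.

Set Implicit Arguments.
Unset Strict Implicit.
Unset Printing Implicit Defensive.

Import Order.TTheory GRing.Theory Num.Theory.
Import numFieldNormedType.Exports.

Local Open Scope classical_set_scope.
Local Open Scope ring_scope.

(** * Graph distance *)

Section GraphDistance.
Variables (V : finType) (e : rel V).
Hypotheses (e_sym : symmetric e) (e_conn : forall u v, connect e u v).
Local Open Scope nat_scope.

Lemma dist_eq0 u v : (dist e u v == 0) = (u == v).
Proof.
apply/idP/idP => [/eqP d0|/eqP <-].
  have := dist_walk (e_conn u v); rewrite d0 => /walkP[p [_ + /size0nil p0]].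
  by rewrite p0 => /= ->.
by rewrite -leqn0; apply: dist_min; apply/walkP; exists [::].
Qed.

Lemma distC u v : dist e u v = dist e v u.
Proof.
suff le_dist x y : dist e x y <= dist e y x by apply/anti_leq; rewrite !le_dist.
have /walkP[p [ep lp <-]] := dist_walk (e_conn y x).
apply: dist_min; apply/walkP; exists (rev (belast y p)); split.
- by rewrite -lp rev_path; apply: sub_path ep => a b; rewrite e_sym.
- by case: p lp {ep} => [//|z p _]; rewrite /= rev_cons last_rcons.
- by rewrite size_rev size_belast.
Qed.

Lemma dist_triangle v u w : dist e u w <= dist e u v + dist e v w.
Proof.
have /walkP[p [ep lp <-]] := dist_walk (e_conn u v).
have /walkP[q [eq lq <-]] := dist_walk (e_conn v w).
by apply: dist_min; apply/walkP; exists (p ++ q);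
  rewrite cat_path last_cat ep lp eq lq size_cat.
Qed.

(** The first step of a shortest path to [v] lowers the distance to [v] by exactly one, so the path
    meets every smaller value. *)
Lemma dist_attained u v j : j <= dist e u v -> exists x, dist e x v = j.
Proof.
move: {-1}(dist e u v) (erefl (dist e u v)) => k; elim: k u => [|k IHk] u.
  by rewrite leqn0 => d0 /eqP ->; exists u.
move=> dk; rewrite leq_eqVlt => /predU1P[->|]; first by exists u.
rewrite ltnS => jk.
have := dist_walk (e_conn u v); rewrite dk => /walkP[[|y p] []//= /andP[uy yp] lp [sp]].
apply: (IHk y) => //; apply/anti_leq/andP; split.
  by apply: dist_min; apply/walkP; exists p.
have uy1 : dist e u y <= 1.
  by apply: dist_min; apply/walkP; exists [:: y]; rewrite /= uy.
have := dist_triangle y u v; lia.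
Qed.

(** If some [x] lies outside the ball, a shortest path from [x] to [v] has a vertex at every
    distance below f/2 from [v]. Otherwise the ball is all of [V]. *)
Lemma card_ball f v : f <= #|V| ->
  f <= 2 * #|[set x | 2 * dist e x v < f]%SET|.
Proof.
move=> fV; have [/forallP allB|/forallPn[x]] := boolP [forall x, 2 * dist e x v < f].
  have -> : [set x | 2 * dist e x v < f]%SET = [set: V]%SET.
    apply/setP => x. rewrite !inE; exact: allB.
  by rewrite cardsT mul2n -addnn (leq_trans fV)// leq_addr.
(* [uphalf f] counts the naturals [j] with [2 * j < f]. *)
rewrite -leqNgt => fx; apply: (@leq_trans (2 * uphalf f)); first lia.
rewrite leq_mul2l /= -[leqLHS](size_iota 0) cardE -(size_map (dist e ^~ v)).
apply: uniq_leq_size (iota_uniq _ _) _ => j; rewrite mem_iota add0n => /= jf.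
have [|y yj] := @dist_attained x v j; first lia.
by apply/mapP; exists y => //; rewrite mem_enum inE yj; lia.
Qed.

End GraphDistance.

(** * Estimates *)

Lemma foldl_preserves (S : Type) (T : eqType) (Q : S -> Prop) (F : S -> T -> S)
    (s : seq T) (h : S) :
  (forall h v, v \in s -> Q h -> Q (F h v)) -> Q h -> Q (foldl F h s).
Proof.
elim: s h => //= v s IHs h QF Qh; apply: IHs; last by apply: QF; rewrite ?inE ?eqxx.
by move=> h' w ws; apply: QF; rewrite inE ws orbT.
Qed.

(** What the step at [v] creates and no step destroys survives to the end of the fold. It serves to
    show that a given pair becomes defined. *)
Lemma foldl_establishes (S : Type) (T : eqType) (Q : S -> Prop) (F : S -> T -> S)
    (s : seq T) (h : S) (v : T) :
  (forall h w, Q h -> Q (F h w)) -> (forall h, Q (F h v)) -> v \in s ->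
  Q (foldl F h s).
Proof.
move=> QF Qv; elim: s h => //= w s IHs h; rewrite inE => /predU1P[<-|]; last exact: IHs.
exact: (@foldl_preserves _ _ Q) (fun h' w' _ => QF h' w') (Qv h).
Qed.

Section Estimates.
Variable V : finType.
Implicit Type h : estimate V.

Lemma assign_some h x y d a b : isSome (h a b) -> isSome (assign h x y d a b).
Proof. by rewrite /assign; case: ifP. Qed.

Lemma update_some f u r h a b : isSome (h a b) -> isSome (update f u r h a b).
Proof.
pose Q h := isSome (h a b); rewrite -[isSome (update _ _ _ _ _ _)]/(Q _) => Qh.
apply: (@foldl_preserves _ _ Q) => [h1 v _ Qh1|].
  by apply: (@foldl_preserves _ _ Q) => // h2 w _; exact: assign_some.
by apply: (@foldl_preserves _ _ Q) => // h1 v _; exact: assign_some.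
Qed.

Lemma update_ball f u r h v w :
  (2 * r v < f)%N -> v != w -> isSome (update f u r h v w).
Proof.
move=> rv vw; pose Q h := isSome (h v w); rewrite -[isSome _]/(Q _) /update.
have assignQ h' x y d : Q h' -> Q (assign h' x y d) by exact: assign_some.
have assignvw h' d : Q (assign h' v w d) by rewrite /Q /assign !eqxx.
(* The second pass skips the centre [u], whose row is filled by the queries themselves. *)
have [vu|vu] := eqVneq v u.
  apply: (@foldl_preserves _ _ Q) => [h' x _ Qh'|].
    by apply: (@foldl_preserves _ _ Q) => // h2 y _; exact: assignQ.
  apply: (@foldl_establishes _ _ Q _ _ _ w); rewrite ?mem_enum// => h' *.
    exact: assignQ.
  by rewrite -vu; exact: assignvw.
apply: (@foldl_establishes _ _ Q _ _ _ v) => [h' x Qh'|h'|].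
- by apply: (@foldl_preserves _ _ Q) => // h2 y _; exact: assignQ.
- apply: (@foldl_establishes _ _ Q _ _ _ w) => [h2 y|h2|]; 
    [exact: assignQ|exact: assignvw|].
  by rewrite mem_enum !inE eq_sym.
- by rewrite mem_enum !inE vu.
Qed.

(** The bounds are imposed on assigned pairs only, so that they hold for the empty estimate and can
    serve as a loop invariant. *)
Definition sound f (delta : V -> V -> nat) h :=
  forall u v, u != v -> forall d, h u v = Some d -> (d <= delta u v <= f * d)%N.

Lemma assign_sound f delta h x y d :
  (forall u v, delta u v = delta v u) -> (x != y -> d <= delta x y <= f * d)%N ->
  sound f delta h -> sound f delta (assign h x y d).
Proof.
move=> deltaC dxy hS u v uv d'; rewrite /assign.
case: ifPn => [+ [<-]|_]; last exact: hS.
case/orP=> /andP[/eqP ux /eqP vy]; first by rewrite ux vy dxy// -ux -vy.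
by rewrite ux vy deltaC dxy// -ux -vy eq_sym.
Qed.

Lemma update_sound (e : rel V) f u h :
  symmetric e -> (forall u v, connect e u v) -> (0 < f)%N ->
  sound f (dist e) h -> sound f (dist e) (update f u (dist e u) h).
Proof.
move=> e_sym e_conn f0 hS; have dC := distC e_sym e_conn.
apply: (@foldl_preserves _ _ (sound f (dist e))) => [h1 v|]; last first.
  apply: (@foldl_preserves _ _ (sound f (dist e))) => // h1 v _.
  apply: assign_sound => // uv.
  by rewrite leqnn leq_pmull.
rewrite mem_enum !inE => /andP[vu vS] h1S.
apply: (@foldl_preserves _ _ (sound f (dist e))) => // h2 w _.
apply: assign_sound => // vw; rewrite inE.
have := dist_triangle e_conn u v w; have := dist_triangle e_conn v u w.
have := dist_eq0 e_conn v w; have := dist_eq0 e_conn v u.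
rewrite (negbTE vw) (negbTE vu) (dC v u) => duv dvw.
move: (dist e u v) (dist e u w) (dist e v w) vS duv dvw => a b c.
(* With [w] in the ball, [1 <= c <= a + b < f] suits the value 1. With [w] outside, [a < b], and
   [b <= a + c] gives the lower bound for the value [b - a]. *)
case: ifPn => [|]; first lia.
rewrite -leqNgt => bf af /negbT a0 /negbT c0 bac cab.
(* with k = b - a >= 1, the bound [c <= 2 a + k <= f k] follows from
   [2 a <= f - 1 <= (f - 1) k], which uses that f is an integer *)
have : (f - 1 <= (f - 1) * (b - a))%N by rewrite leq_pmulr; lia.
rewrite mulnBl mul1n; lia.
Qed.

End Estimates.

(** * Runs of the algorithm on finitely many choices *)

Section Execution.
Variables (V : finType) (delta : V -> V -> nat) (f : nat).

Definition outcome us := Defs.eval delta (approx_reconstruction f us).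
Definition cost us := queries delta (approx_reconstruction f us).

Lemma eval_query_all A u vs r (k : (V -> nat) -> oracle_prog V A) :
  Defs.eval delta (query_all u vs r k) =
  Defs.eval delta (k (fun w => if w \in vs then delta u w else r w)).
Proof.
elim: vs r => //= v vs IHvs r; rewrite IHvs; congr (Defs.eval _ (k _)); apply/funext => w.
by rewrite inE; case: (eqVneq w v) => [->|]//=; case: ifP.
Qed.

Lemma queries_query_all A u vs r (k : (V -> nat) -> oracle_prog V A) :
  queries delta (query_all u vs r k) =
  (size vs + queries delta (k (fun w => if w \in vs then delta u w else r w)))%N.
Proof.
elim: vs r => //= v vs IHvs r; rewrite IHvs addSn.
congr (_ + queries _ (k _)).+1; apply/funext => w.
by rewrite inE; case: (eqVneq w v) => [->|]//=; case: ifP.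
Qed.

Lemma all_answers u :
  (fun w => if w \in enum V then delta u w else 0%N) = delta u.
Proof. by apply/funext => w; rewrite mem_enum. Qed.

(** The program consumes its choices from the front; peeling off the last one shows the estimate
    evolving round by round. The induction runs over an arbitrary starting estimate. *)
Lemma outcome_rcons us u :
  outcome (rcons us u) =
  if fully_defined (outcome us) then outcome us
  else update f u (delta u) (outcome us).
Proof.
rewrite /outcome /approx_reconstruction.
elim: us (fun _ _ => None) => [|v us IHus] h /=.
  by case: ifP => hf /=; rewrite hf// eval_query_all all_answers; case: ifP.
by case: ifP => [/=->//|_]; rewrite !eval_query_all all_answers IHus.
Qed.

Lemma cost_rcons us u :
  cost (rcons us u) = (cost us + (~~ fully_defined (outcome us)) * #|V|)%N.
Proof.
rewrite /outcome /cost /approx_reconstruction.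
elim: us (fun _ _ => None) => [|v us IHus] h /=.
  case: ifP => hf /=; rewrite hf //= queries_query_all all_answers -cardT.
  by case: ifP; rewrite mul1n /= addn0 add0n.
case: ifP => [/=->//|_]; rewrite !queries_query_all eval_query_all all_answers.
by rewrite IHus addnA.
Qed.

(** The round that picks [u] fills the row of [v], and later rounds keep it filled. If the loop
    stopped before that round, every pair is already defined. *)
Lemma outcome_ball us u v w : u \in us -> (2 * delta u v < f)%N -> v != w ->
  isSome (outcome us v w).
Proof.
move=> + uv vw; elim/last_ind: us => // us x IHus; rewrite mem_rcons inE outcome_rcons.
case: ifPn => [/forallP/(_ v)/forallP/(_ w)/implyP/(_ vw)//|_].
by case/predU1P => [<-|/IHus]; [exact: update_ball|exact: update_some].
Qed.

Lemma fully_defined_cover us :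
  (forall v, exists2 u, u \in us & (2 * delta u v < f)%N) ->
  fully_defined (outcome us).
Proof.
move=> cover; apply/forallP => v; apply/forallP => w; apply/implyP.
by have [u] := cover v; exact: outcome_ball.
Qed.

Lemma cost_mkseq (us : nat -> V) t :
  cost (mkseq us t) =
  (\sum_(s < t) ~~ fully_defined (outcome (mkseq us s)) * #|V|)%N.
Proof.
elim: t => [|t IHt]; last by rewrite mkseqS cost_rcons IHt big_ord_recr.
by rewrite big_ord0 /cost /approx_reconstruction /=; case: ifP.
Qed.

End Execution.

Lemma outcome_sound (V : finType) (e : rel V) f us :
  symmetric e -> (forall u v, connect e u v) -> (0 < f)%N ->
  sound f (dist e) (outcome (dist e) f us).
Proof.
move=> e_sym e_conn f0; elim/last_ind: us => [|us u IHus].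
  by rewrite /outcome /approx_reconstruction /=; case: ifP.
by rewrite outcome_rcons; case: ifP => // _; exact: update_sound.
Qed.

Lemma returns_approximates (V : finType) (e : rel V) f (us : nat -> V) h :
  symmetric e -> (forall u v, connect e u v) -> (0 < f)%N ->
  returns (dist e) f us h -> approximates f (dist e) h.
Proof.
move=> e_sym e_conn f0 [t [-> hf]] u v uv.
have := @outcome_sound _ e f (mkseq us t) e_sym e_conn f0 u v uv.
move/forallP: hf => /(_ u)/forallP/(_ v)/implyP/(_ uv).
rewrite -/(outcome _ _ _); case: (outcome _ _ _ u v) => // d _.
by move=> /(_ d erefl) dB; exists d.
Qed.

(** * Probability that a ball is never hit *)

Section Sampling.
Context (R : realType) (d : measure_display) (Omega : measurableType d).
Context (P : probability Omega R) (V : finType) (U : nat -> Omega -> V).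
Hypothesis U_iid : iid_uniform P U.
Local Notation n := #|V|.

(** A probability space is nonempty, and [U 0] sends any of its points to a vertex. *)
Lemma sample_space_gt0 : (0 < n)%N.
Proof.
have [w _] : [set: Omega] !=set0.
  apply/set0P/eqP => /(congr1 P); rewrite probability_setT measure0 => /eqP.
  by rewrite eqe oner_eq0.
by apply/card_gt0P; exists (U 0%N w).
Qed.

Lemma iid_uniform_mem k (A : {set V}) :
  P [set w | U k w \in A] = (#|A|%:R / n%:R)%:E.
Proof.
have [mU U1 _] := U_iid; rewrite cardE.
rewrite (_ : [set w | _] = [set w | U k w \in enum A]); last first.
  by apply/seteqP; split=> w /=; rewrite mem_enum.
elim: (enum A) (enum_uniq A) => [_|v s IHs /= /andP[vs us]].
  rewrite (_ : [set w | _] = set0) ?measure0 ?mul0r//.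
  by apply/seteqP; split=> w.
have mS (r : seq V) : measurable [set w | U k w \in r].
  rewrite (_ : [set w | _] = [set w | U k w \in [set x in r]%SET])//.
  by apply/seteqP; split=> w /=; rewrite inE.
have mv : measurable [set w | U k w = v].
  rewrite (_ : [set w | _] = [set w | U k w \in [:: v]])//.
  by apply/seteqP; split=> w /=; rewrite inE => /eqP.
rewrite (_ : [set w | _] = [set w | U k w = v] `|` [set w | U k w \in s]).
  rewrite measureU//; last first.
    by apply/seteqP; split=> w //= [Uv]; rewrite Uv (negbTE vs).
  apply: etrans (congr2 +%E (U1 k v) (IHs us)) _.
  by rewrite -EFinD -natr1 mulrDl mul1r addrC.
apply/seteqP; split=> w /=; first by rewrite inE => /predU1P.
by rewrite inE => -[->|->]; rewrite ?eqxx ?orbT.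
Qed.

Lemma measurable_iid_cylinder (I : seq nat) (A : {set V}) :
  measurable [set w | forall i, i \in I -> U i w \in A].
Proof.
have [mU _ _] := U_iid.
rewrite (_ : [set w | _] = \bigcap_(i in [set` I]) [set w | U i w \in A])//.
exact: fin_bigcap_measurable.
Qed.

Lemma probability_miss (A : {set V}) t :
  P [set w | forall i, i \in iota 0 t -> U i w \in (~: A)%SET] =
  ((1 - #|A|%:R / n%:R) ^+ t)%:E.
Proof.
have [_ _ indep] := U_iid; rewrite (indep _ (fun=> ~: A)%SET) ?iota_uniq//.
have n0 : (n%:R : R) != 0 by rewrite pnatr_eq0 -lt0n sample_space_gt0.
have -> : 1 - #|A|%:R / n%:R = #|~: A|%SET%:R / n%:R :> R.
  apply: (mulIf n0); rewrite mulrBl !divfK// mul1r.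
  by rewrite -[n in LHS](cardsC A) natrD addrC addKr.
(* The start of [iota] is generalized, since the tail of the list starts one later. *)
elim: t 0%N => [|t IHt] m; first by rewrite big_nil expr0.
by rewrite big_cons IHt iid_uniform_mem -EFinM exprS.
Qed.

Definition uncovered (B : V -> {set V}) (s : seq V) t : set Omega :=
  [set w | exists2 v, v \in s & forall i, i \in iota 0 t -> U i w \in (~: B v)%SET].

Lemma uncovered_cons (B : V -> {set V}) v s t :
  uncovered B (v :: s) t =
  [set w | forall i, i \in iota 0 t -> U i w \in (~: B v)%SET] `|` uncovered B s t.
Proof.
apply/seteqP; split=> w /= => [[x]|[Uv|[x xs Ux]]].
- by rewrite inE => /predU1P[->|xs Ux]; [left|right; exists x].
- by exists v; rewrite ?inE ?eqxx.
- by exists x; rewrite // inE xs orbT.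
Qed.

Lemma uncovered_nil (B : V -> {set V}) t : uncovered B [::] t = set0.
Proof. by apply/seteqP; split=> w // []. Qed.

Lemma measurable_uncovered (B : V -> {set V}) s t : measurable (uncovered B s t).
Proof.
elim: s => [|v s IHs]; first by rewrite uncovered_nil.
by rewrite uncovered_cons; apply: measurableU => //; exact: measurable_iid_cylinder.
Qed.

(** Union bound, by induction on the list [s]. *)
Lemma probability_uncovered (B : V -> {set V}) s t (p : R) :
  (forall v, p <= #|B v|%:R / n%:R) ->
  (P (uncovered B s t) <= ((size s)%:R * (1 - p) ^+ t)%:E)%E.
Proof.
have ratio_le1 v : #|B v|%:R / n%:R <= 1 :> R.
  rewrite ler_pdivrMr ?mul1r ?ler_nat ?max_card// ltr0n.
  by apply/card_gt0P; exists v.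
move=> pB; elim: s => [|v s IHs]; first by rewrite uncovered_nil measure0 mul0r.
rewrite uncovered_cons /= -natr1 mulrDl mul1r addrC EFinD.
apply: le_trans (measureU2 P _ _) _; first exact: measurable_iid_cylinder.
  exact: measurable_uncovered.
apply: leeD IHs; rewrite [leLHS]probability_miss lee_fin.
have := pB v; have := ratio_le1 v => ? ?.
by rewrite lerXn2r ?nnegrE//; lra.
Qed.

End Sampling.

(** * Monotone integrals and geometric tails *)

(** The integral of a nonnegative function is a supremum over the simple functions below it, and a
    larger function has more of them. This covers [total_queries], whose measurability is not
    established. *)
Lemma ge0_integral_mono d (T : measurableType d) (R : realType)
    (mu : {measure set T -> \bar R}) (f g : T -> \bar R) :
  (forall x, 0 <= f x)%E -> (forall x, f x <= g x)%E ->
  (\int[mu]_x f x <= \int[mu]_x g x)%E.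
Proof.
move=> f0 fg; have g0 x : (0 <= g x)%E := le_trans (f0 x) (fg x).
rewrite !ge0_integralTE//; apply: ereal_sup_le => _ [h hf <-].
by exists h => // x; exact: le_trans (hf x) (fg x).
Qed.

(** The first [m] terms are bounded by 1 each, the others by a geometric series with first term
    [a * q ^+ m]. *)
Lemma nneseries_geometric_tail (R : realType) (u : nat -> \bar R) (a q : R) m :
  (forall t, 0 <= u t <= 1)%E -> (forall t, u t <= (a * q ^+ t)%:E)%E ->
  0 <= a -> 0 < q < 1 ->
  (\sum_(0 <= t <oo) u t <= (m%:R + a * q ^+ m / (1 - q))%:E)%E.
Proof.
move=> u01 ua a0 /andP[q0 q1]; have u0 t : (0 <= u t)%E by case/andP: (u01 t).
rewrite (nneseries_split _ m)// add0n EFinD leeD//.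
  rewrite (_ : m%:R = \sum_(0 <= t < m) 1)%R; last first.
    by rewrite big_const_nat subn0 iter_addr_0.
  by rewrite -sumEFin lee_sum// => t _; case/andP: (u01 t).
rewrite -nneseries_addn//; apply: lime_le.
  by apply: is_cvg_nneseries.
apply: nearW => k; apply: (@le_trans _ _ (series (geometric (a * q ^+ m) q) k)%:E).
  rewrite /series /= -sumEFin lee_sum// => t _.
  by rewrite -mulrA -exprD addnC.
rewrite lee_fin; apply: geometric_le_lim => //; last by rewrite ger0_norm// ltW.
by rewrite mulr_ge0// exprn_ge0// ltW.
Qed.

(** * Expected number of queries *)

(** After about [ln n / p] rounds the union bound [n * (1 - p) ^+ m] has dropped to at most 1, so
    the tail adds at most [1 / p]. *)
Lemma query_bound_arith (R : realType) (n f : nat) :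
  (0 < f <= n)%N -> 1 <= ln n%:R :> R ->
  let p : R := f%:R / (2 * n%:R) in
  exists m, n%:R * (m%:R + n%:R * (1 - p) ^+ m / p) <=
            6 * (n%:R ^+ 2 * ln n%:R / f%:R).
Proof.
move=> /andP[f0 fn] L1 p.
have n_gt0 : 0 < n%:R :> R by rewrite ltr0n (leq_trans f0).
have f_gt0 : 0 < f%:R :> R by rewrite ltr0n.
have fn' : f%:R <= n%:R :> R by rewrite ler_nat.
have p0 : 0 < p by rewrite divr_gt0// mulr_gt0.
have p1 : p <= 1 by rewrite ler_pdivrMr ?mulr_gt0//; lra.
set L := ln n%:R in L1 *.
have Lp0 : 0 <= L / p by rewrite divr_ge0 ?ltW//; lra.
have /andP[mL Lm] := truncn_itv Lp0.
set m := Num.truncn (L / p) in mL Lm; exists m.+1.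
(* Since [1 - p <= expR (- p)], it is enough that [L <= p * m.+1]; hence the successor of the
   truncation of [L / p]. *)
have qm : n%:R * (1 - p) ^+ m.+1 <= 1.
  have qexp : 1 - p <= expR (- p) by exact: expR_ge1Dx.
  apply: (@le_trans _ _ (n%:R * expR (- p) ^+ m.+1)).
    by rewrite ler_pM2l// lerXn2r// nnegrE ?expR_ge0// subr_ge0.
  rewrite -expRM_natr mulNr expRN ler_pdivrMr ?expR_gt0// mul1r.
  rewrite -[leLHS]lnK ?posrE// ler_expR -/L.
  by move: Lm => /ltW; rewrite ler_pdivrMr// mulrC.
(* As [1 <= 1 / p <= L / p], the number [m.+1] is at most [2 * (L / p)] and the tail at most
   [L / p]. Then [1 / p = 2 * n / f] turns the factor 3 into 6. *)
apply: (@le_trans _ _ (n%:R * (3 * (L / p)))); last first.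
  rewrite (_ : _ * _ = 6 * (n%:R ^+ 2 * L / f%:R))// /p.
  by field; rewrite !gt_eqF.
rewrite ler_pM2l//.
have tail : n%:R * (1 - p) ^+ m.+1 / p <= p^-1 by rewrite ler_pdivrMr// mulVf ?gt_eqF.
have p1V : 1 <= p^-1 by rewrite invf_ge1.
have LpV : p^-1 <= L / p by rewrite ler_peMl// invr_ge0 ltW.
by rewrite -natr1; lra.
Qed.

Section ExpectedQueries.
Context (R : realType) (d : measure_display) (Omega : measurableType d).
Context (P : probability Omega R) (V : finType) (U : nat -> Omega -> V).
Hypothesis U_iid : iid_uniform P U.
Variables (delta : V -> V -> nat) (f : nat).
Local Notation n := #|V|.

Let ball v := [set x | (2 * delta x v < f)%N]%SET.

Lemma fully_defined_not_uncovered w t :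
  ~ uncovered U ball (enum V) t w ->
  fully_defined (outcome delta f (mkseq (U^~ w) t)).
Proof.
move=> cov; apply: fully_defined_cover => v; apply: contrapT => nhit; apply: cov.
exists v; rewrite ?mem_enum// => i it; rewrite !inE; apply/negP => hit.
by apply: nhit; exists (U i w) => //; apply/mapP; exists i.
Qed.

(** While the loop runs, some ball has not been hit, so the [n] queries of each round are charged to
    the indicator of [uncovered], a measurable event. *)
Lemma total_queries_le w :
  (total_queries R delta f (U^~ w) <=
   \sum_(0 <= t <oo) n%:R%:E * (\1_(uncovered U ball (enum V) t) w)%:E)%E.
Proof.
have term0 t : (0 <= n%:R%:E * (\1_(uncovered U ball (enum V) t) w)%:E :> \bar R)%E.
  by rewrite -EFinM lee_fin mulr_ge0.
apply: ge_ereal_sup => _ [t _ <-]; rewrite -/(cost _ _ _) cost_mkseq.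
apply: (@le_trans _ _ (\sum_(0 <= s < t)
  n%:R%:E * (\1_(uncovered U ball (enum V) s) w)%:E)%E); last exact: nneseries_lim_ge.
rewrite big_mkord natr_sum -sumEFin lee_sum// => s _.
rewrite -EFinM lee_fin natrM mulrC ler_wpM2l//.
rewrite indicE; case: (boolP (w \in _)) => [_|]; first by case: (fully_defined _).
by rewrite notin_setE => /fully_defined_not_uncovered ->.
Qed.

Lemma expected_queries_le :
  (\int[P]_w total_queries R delta f (U^~ w) <=
   n%:R%:E * \sum_(0 <= t <oo) P (uncovered U ball (enum V) t))%E.
Proof.
have mA t := measurable_uncovered U_iid ball (enum V) t.
have mI t : measurable_fun [set: Omega]
    (EFin \o (\1_(uncovered U ball (enum V) t) : Omega -> R)).
  by apply/measurable_EFinP; exact: measurable_indic.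
apply: le_trans (ge0_integral_mono _ _ total_queries_le) _.
  move=> w; apply: (@le_trans _ _ ((cost delta f (mkseq (U^~ w) 0))%:R%:E)).
    by rewrite lee_fin.
  by apply: ereal_sup_ubound; exists 0%N.
rewrite integral_nneseries//=; last first.
  by move=> t; exact: (measurable_funeM _ (mI t)).
rewrite -nneseriesZl//; apply: lee_nneseries => [t _ _|t _].
  by apply: integral_ge0 => w _; rewrite -EFinM lee_fin mulr_ge0.
rewrite (ge0_integralZl_EFin _ _ _ (mI t)) ?integral_indic ?setIT// => w _.
by rewrite lee_fin.
Qed.

(** A run that never returns lies in [A t] for every [t], and the union bound makes [P (A t)] tend
    to 0. *)
Lemma ae_returns : (0 < f)%N -> (forall v, delta v v = 0%N) ->
  {ae P, forall w, exists h, returns delta f (U^~ w) h}.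
Proof.
move=> f0 delta0; pose A t := uncovered U ball (enum V) t.
have mA t : measurable (A t) := measurable_uncovered U_iid ball (enum V) t.
exists (\bigcap_t A t); split; first exact: bigcapT_measurable.
  apply/eqP; rewrite eq_le measure_ge0 andbT; apply/lee_addgt0Pr => eps eps0.
  have n1 : 1 <= n%:R :> R by rewrite ler1n (sample_space_gt0 P U).
  (* Each ball contains its centre, so it holds at least the fraction [1 / n] of the vertices,
     whatever the size of the positive [f]. *)
  pose p : R := n%:R^-1.
  have p0 : 0 < p by rewrite invr_gt0 (lt_le_trans ltr01).
  have p1 : p <= 1 by rewrite invf_le1 // (lt_le_trans ltr01).
  have q1 : `|1 - p| < 1 by rewrite ger0_norm; lra.
  have [t _ /(_ _ (leqnn t)) At] := cvgr0_norm_lt _ (cvg_geometric (n%:R : R) q1) _ eps0.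
  rewrite add0e; apply: (@le_trans _ _ (P (A t))).
    by apply: le_measure; rewrite ?inE//; [exact: bigcapT_measurable|exact: bigcap_inf].
  apply: le_trans (@probability_uncovered _ _ _ _ _ _ U_iid ball _ t p _) _.
    move=> v; rewrite ler_peMl ?ler1n// ?(ltW p0)//.
    by apply/card_gt0P; exists v; rewrite inE delta0 muln0.
  by rewrite lee_fin -cardE; apply: le_trans (ltW At); exact: ler_norm.
move=> w nret t _; apply: contrapT => /fully_defined_not_uncovered fd.
by apply: nret; exists (outcome delta f (mkseq (U^~ w) t)), t.
Qed.

End ExpectedQueries.

Theorem theorem3 (R : realType) :
  exists C : R,
  forall f : nat -> nat, sublinear R f ->
  exists N : nat,
  forall (V : finType) (e : rel V),
    symmetric e -> irreflexive e -> (forall u v, connect e u v) ->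
    (0 < f #|V|)%N ->
  forall (d : measure_display) (Omega : measurableType d)
    (P : probability Omega R) (U : nat -> Omega -> V),
    iid_uniform P U ->
  [/\ {ae P, forall w, exists h, returns (dist e) (f #|V|) (U^~ w) h},
      forall w h, returns (dist e) (f #|V|) (U^~ w) h ->
        approximates (f #|V|) (dist e) h
    & (N <= #|V|)%N ->
      (\int[P]_w total_queries R (dist e) (f #|V|) (U^~ w)
        <= (C * (#|V|%:R ^+ 2 * ln #|V|%:R / (f #|V|)%:R))%:E)%E ].
Proof.
exists 6 => f f_sub.
have [N0 _ f_lt] := cvgr0_norm_lt _ f_sub _ ltr01.
(* From [N0] on, sublinearity gives [f n < n]; the other threshold exceeds e and ensures
   [1 <= ln n]. *)
exists (maxn N0 (Num.truncn (expR 1 : R)).+1) => V e e_sym _ e_conn f0.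
move=> d Omega P U U_iid; split.
- by apply: ae_returns => // v; apply/eqP; rewrite dist_eq0.
- by move=> w h; exact: returns_approximates.
rewrite geq_max => /andP[/f_lt /= fn1 expn].
have n0 : (0 < #|V|)%N := sample_space_gt0 P U.
have fn : (f #|V| <= #|V|)%N.
  by move: fn1; rewrite ger0_norm// ltr_pdivrMr ?ltr0n// mul1r ltr_nat => /ltnW.
have L1 : 1 <= ln #|V|%:R :> R.
  rewrite -[leLHS]expRK ler_ln ?posrE ?expR_gt0 ?ltr0n//.
  by rewrite (le_trans (ltW (truncnS_gt _)))// ler_nat.
have := @query_bound_arith R #|V| (f #|V|); rewrite f0 fn => /(_ isT L1)[m].
set p := _ / _ => bound; apply: le_trans (expected_queries_le U_iid _ _) _.
have f0R : 0 < (f #|V|)%:R :> R by rewrite ltr0n.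
have n0R : 0 < #|V|%:R :> R by rewrite ltr0n.
have fnR : (f #|V|)%:R <= #|V|%:R :> R by rewrite ler_nat.
have p0 : 0 < p by rewrite divr_gt0// mulr_gt0.
have p1 : p < 1 by rewrite ltr_pdivrMr ?mulr_gt0//; lra.
apply: le_trans (_ : _ <= (#|V|%:R * (m%:R + #|V|%:R * (1 - p) ^+ m / p))%:E)%E _;
  last by rewrite lee_fin.
rewrite EFinM lee_wpmul2l ?lee_fin//.
(* The ratio of the tail is [q = 1 - p], so the denominator [p] is put in the form [1 - q]. *)
rewrite -[p in X in (_ / X)](subKr 1).
apply: nneseries_geometric_tail => [t|t||] //; last 1 first.
- by rewrite subr_gt0 p1 /= gtrBl.
- by rewrite measure_ge0 probability_le1//; exact: measurable_uncovered U_iid _ _ _.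
rewrite cardE; apply: probability_uncovered => // v; rewrite -cardE.
(* With [p = f / (2 * n)], the claim says that the ball has at least f/2 elements, which rests on
   [f <= n]. *)
rewrite /p invfM mulrCA mulrA ler_pM2r ?invr_gt0//.
rewrite mulrC ler_pdivrMr// -natrM ler_nat mulnC; exact: card_ball.
Qed.
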